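(* Let $n\ge 2$. The maximum value of $\mathrm{s}^+_{\mathcal B}(\pi)$ over all $\pi\in S_n$ is $(2m^2-1)/(2m-1)$ when $n=2m$, and $(2m^2+2m-1)/(2m)$ when $n=2m+1$. When $n=2m$, the maximum is attained by precisely those permutations $\pi\in S_n$ that oscillate between $\{1,\dots,m\}$ and $\{m+1,\dots,n\}$ and satisfy $(\pi(1),\pi(n))\in\{(m,m+1),(m+1,m)\}$. When $n=2m+1$, the maximum is attained precisely by those permutations $\pi\in S_n$ that oscillate between $\{1,\dots,m\}$ and $\{m+1,\dots,n\}$ and satisfy $(\pi(1),\pi(n))\in\{(m+1,m+2),(m+2,m+1)\}$, and by those that oscillate between $\{1,\dots,m+1\}$ and $\{m+2,\dots,n\}$ and satisfy $(\pi(1),\pi(n))\in\{(m,m+1),(m+1,m)\}$.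
   Context: $S_n$ is the set of all permutations of $N=\{1,\dots,n\}$. For $\pi\in S_n$, $$\mathrm{s}^+_{\mathcal B}(\pi)=\frac{1}{n-1}\sum_{i=1}^{n-1}|\pi(i)-\pi(i+1)|$$ (the additive stretch of $\pi$ with respect to $\mathcal B=\{\{i,i+1\}:1\le i<n\}$). For subsets $A,B\subseteq N$, $\pi\in S_n$ oscillates between $A$ and $B$ if for every $1\le i<n$ either $\pi(i)\in A$ and $\pi(i+1)\in B$, or $\pi(i)\in B$ and $\pi(i+1)\in A$. *)

(* Defs.v *)
From mathcomp Require Import all_boot all_order all_algebra all_fingroup.
Set Implicit Arguments.
Unset Strict Implicit.
Unset Printing Implicit Defensive.
Import Order.TTheory GRing.Theory Num.Theory.
Local Open Scope ring_scope.

(* The set N = {1, ..., n} is represented by 'I_n, the ordinal i standing for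
   the number i.+1; 'S_n is then the set of all permutations of N. *)
Definition label (n : nat) (i : 'I_n) : nat := i.+1.

Definition label_range (n a b : nat) : {set 'I_n} :=
  [set x : 'I_n | (a <= label x <= b)%N].

(* The inner sum has exactly one term when i is not the last element of N, and
   none otherwise. *)
Definition additive_stretch (n : nat) (pi : 'S_n) : rat :=
  (\sum_(i < n) \sum_(j < n | label j == (label i).+1)
      `| (label (pi i))%:R - (label (pi j))%:R |) / (n%:R - 1).

Definition oscillates (n : nat) (pi : 'S_n) (A B : {set 'I_n}) : Prop :=
  forall i j : 'I_n, label j = (label i).+1 ->
    (pi i \in A /\ pi j \in B) \/ (pi i \in B /\ pi j \in A).

(* (pi(1), pi(n)) = (a, b) *)
Definition endpoints (n : nat) (pi : 'S_n) (a b : nat) : Prop :=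
  exists i j : 'I_n,
    [/\ label i = 1%N, label j = n, label (pi i) = a & label (pi j) = b].

Definition attains_max (n : nat) (pi : 'S_n) : Prop :=
  forall sigma : 'S_n, additive_stretch sigma <= additive_stretch pi.

Definition max_stretch_is (n : nat) (v : rat) : Prop :=
  (exists pi : 'S_n, additive_stretch pi = v) /\
  (forall pi : 'S_n, additive_stretch pi <= v).

(* Main.v *)
(* Let g x = 2 x - n - 1 be twice the deviation of x from the median of N.  Then
   2 |a - b| = |g a| + |g b| - slack, where slack >= 0 vanishes exactly when a
   and b lie weakly on opposite sides of the median.  Summed along pi, every |g x|
   is counted twice, except for the two endpoints, which count once.  As the
   endpoints are distinct, they contribute at least 2 to the deficit; hence the
   bound, with equality iff every step weakly crosses the median and the
   endpoint deviations add up to 2.  For odd n one endpoint is then the median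
   itself, and the parity of the remaining 2m positions decides on which side it
   has to be counted. *)
Require Import Defs.
From mathcomp Require Import all_boot all_order all_algebra all_fingroup.
From mathcomp Require Import zify ring.
Set Implicit Arguments.
Unset Strict Implicit.
Unset Printing Implicit Defensive.
Import Order.TTheory GRing.Theory Num.Theory.
Local Open Scope ring_scope.

(** * Labels read along a permutation of p + 1 elements, positions counted from 0 *)

Definition plabel (p : nat) (pi : 'S_p.+1) (k : nat) : nat :=
  label (pi (inord k)).

Definition stretch_sum (p : nat) (pi : 'S_p.+1) : int :=
  \sum_(i < p) `|(plabel pi i)%:Z - (plabel pi i.+1)%:Z|.

(** The function g at n = p + 1; the doubling keeps it integral when the median is a
    half-integer. *)
Definition centered (p : nat) (pi : 'S_p.+1) (k : nat) : int :=
  2 * (plabel pi k)%:Z - p%:Z - 2.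

(** The bounds matter: [inord] sends every position above [p] to 0. *)
Lemma plabel_inj (p : nat) (pi : 'S_p.+1) (j k : nat) :
  (j <= p)%N -> (k <= p)%N -> plabel pi j = plabel pi k -> j = k.
Proof.
move=> jp kp [] /val_inj /perm_inj /(congr1 val) /=.
by rewrite !inordK ?ltnS.
Qed.

Lemma additive_stretchE (p : nat) (pi : 'S_p.+1) :
  additive_stretch pi = (stretch_sum pi)%:~R / p%:R.
Proof.
rewrite /additive_stretch -natr1 addrK; congr (_ / _).
rewrite big_ord_recr /= [X in _ + X]big1 ?addr0; last first.
  by move=> j /eqP[] jp; have := ltn_ord j; rewrite jp ltnn.
rewrite /stretch_sum rmorph_sum /=; apply: eq_bigr => i _.
rewrite (big_pred1 (inord i.+1)) => [|j]; last first.
  by rewrite /= -val_eqE /= inordK ?ltnS // eqSS.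
rewrite intr_norm rmorphB /= -!pmulrn /plabel.
suff -> : inord i = widen_ord (leqnSn p) i by [].
by apply: val_inj; rewrite /= inordK // ltnS ltnW.
Qed.

(** * Slack, total deviation and the upper bound *)

Definition slack (a b : int) : int := `|a| + `|b| - `|a - b|.

Lemma slack_ge0 (a b : int) : 0 <= slack a b.
Proof. by rewrite subr_ge0 ler_normB. Qed.

Lemma slack_eq0 (a b : int) :
  (slack a b == 0) = (a <= 0) && (0 <= b) || (0 <= a) && (b <= 0).
Proof. rewrite /slack; lia. Qed.

Lemma sum_consecutive (g : nat -> int) (p : nat) :
  \sum_(i < p) (g i + g i.+1) = 2 * \sum_(i < p.+1) g i - g 0 - g p.
Proof.
rewrite big_split /=.
have E1 : \sum_(i < p.+1) g i = \sum_(i < p) g i + g p by rewrite big_ord_recr.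
have E2 : \sum_(i < p.+1) g i = g 0 + \sum_(i < p) g i.+1.
  by rewrite big_ord_recl.
rewrite mulr_natl mulr2n {1}E1 E2; ring.
Qed.

(** The sum of |g x| over N: the ordinal x has label x + 1, and 2 (x + 1) - n - 1 = 2 x + 1 - n. *)
Definition total_deviation (n : nat) : int :=
  \sum_(x < n) `|2 * (x : nat)%:Z + 1 - n%:Z|.

(** Dropping the smallest and the largest of n + 2 labels keeps the median in the middle of the
    rest; each dropped label has deviation n + 1. *)
Lemma total_deviationSS (n : nat) :
  total_deviation n.+2 = total_deviation n + 2 * (n%:Z + 1).
Proof.
rewrite /total_deviation big_ord_recr big_ord_recl /=.
under eq_bigr => i _.
  have -> : `|2 * (bump 0 i)%:Z + 1 - n.+2%:Z| = `|2 * (i : nat)%:Z + 1 - n%:Z|.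
    by rewrite /bump /=; lia.
  over.
set S := \sum_(i < n) _.
lia.
Qed.

Lemma total_deviation_even (m : nat) : total_deviation (2 * m) = 2 * m%:Z ^+ 2.
Proof.
elim: m => [|m IH]; first by rewrite /total_deviation big_ord0.
have -> : (2 * m.+1 = (2 * m).+2)%N by lia.
rewrite total_deviationSS IH -natr1 !natz PoszM; ring.
Qed.

Lemma total_deviation_odd (m : nat) :
  total_deviation (2 * m + 1) = 2 * m%:Z ^+ 2 + 2 * m%:Z.
Proof.
elim: m => [|m IH]; first by rewrite /total_deviation big_ord_recl big_ord0.
have -> : (2 * m.+1 + 1 = (2 * m + 1).+2)%N by lia.
rewrite total_deviationSS IH -natr1 !natz PoszD PoszM; ring.
Qed.

Lemma sum_centered (p : nat) (pi : 'S_p.+1) :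
  \sum_(i < p.+1) `|centered pi i| = total_deviation p.+1.
Proof.
rewrite /total_deviation [RHS](reindex_inj (@perm_inj _ pi)) /=.
apply: eq_bigr => i _; rewrite /centered /plabel inord_val /label; lia.
Qed.

Definition total_slack (p : nat) (pi : 'S_p.+1) : int :=
  \sum_(i < p) slack (centered pi i) (centered pi i.+1).

Lemma total_slack_ge0 (p : nat) (pi : 'S_p.+1) : 0 <= total_slack pi.
Proof. by apply: sumr_ge0 => i _; exact: slack_ge0. Qed.

Lemma stretch_sum_balance (p : nat) (pi : 'S_p.+1) :
  2 * stretch_sum pi + total_slack pi +
    (`|centered pi 0| + `|centered pi p|) = 2 * total_deviation p.+1.
Proof.
have := sum_consecutive (fun i => `|centered pi i|) p.
rewrite sum_centered => E.
suff -> : 2 * stretch_sum pi + total_slack pi =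
    \sum_(i < p) (`|centered pi i| + `|centered pi i.+1|) by rewrite E; ring.
rewrite /stretch_sum /total_slack mulr_sumr -big_split /=; apply: eq_bigr => i _.
(* The centering cancels in differences, so |g a - g b| = 2 |a - b|. *)
rewrite /slack /centered; lia.
Qed.

(** All centered values have the same parity, so distinct ones differ by at least 2; the triangle
    inequality concludes. *)
Lemma centered_ends (p : nat) (pi : 'S_p.+1) : (0 < p)%N ->
  2 <= `|centered pi 0| + `|centered pi p|.
Proof.
move=> p0; have : plabel pi 0 <> plabel pi p.
  by move=> /plabel_inj => /(_ isT (leqnn _)); lia.
rewrite /centered; lia.
Qed.

Definition extremal (p : nat) (pi : 'S_p.+1) : Prop :=
  (forall i, (i < p)%N -> slack (centered pi i) (centered pi i.+1) = 0) /\
  `|centered pi 0| + `|centered pi p| = 2.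

Lemma stretch_sum_le (p : nat) (pi : 'S_p.+1) : (0 < p)%N ->
  stretch_sum pi <= total_deviation p.+1 - 1.
Proof.
move=> p0; have := stretch_sum_balance pi; have := centered_ends pi p0.
have := total_slack_ge0 pi; lia.
Qed.

Lemma stretch_sum_eq (p : nat) (pi : 'S_p.+1) : (0 < p)%N ->
  stretch_sum pi = total_deviation p.+1 - 1 <-> extremal pi.
Proof.
move=> p0; have B := stretch_sum_balance pi; have E := centered_ends pi p0.
have S := total_slack_ge0 pi.
split=> [H|[H1 H2]].
  have Z : total_slack pi == 0 by apply/eqP; lia.
  split; last by lia.
  move=> i ip; move: Z; rewrite psumr_eq0 => [|j _]; last exact: slack_ge0.
  by move=> /allP /(_ (Ordinal ip)); rewrite mem_index_enum => /(_ isT) /eqP.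
have : total_slack pi = 0 by apply: big1 => i _; exact: H1.
lia.
Qed.

(** * From the equality case to oscillation *)

Lemma oscillatesE (p : nat) (pi : 'S_p.+1) (a : nat) :
  oscillates pi (label_range p.+1 1 a) (label_range p.+1 a.+1 p.+1) <->
  forall i, (i < p)%N -> (plabel pi i <= a)%N != (plabel pi i.+1 <= a)%N.
Proof.
(* The two ranges are complementary, so one comparison with [a] decides both memberships. *)
have P (x : 'I_p.+1) :
    ((x \in label_range p.+1 1 a) = (label x <= a)%N) *
    ((x \in label_range p.+1 a.+1 p.+1) = (a < label x)%N).
  by rewrite !inE /label; have := ltn_ord x; split; lia.
split=> [H i ip|H i j].
  have := H (inord i) (inord i.+1); rewrite /label !inordK ?ltnS ?(ltnW ip) //.
  by move/(_ erefl); rewrite !P /plabel; lia.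
rewrite /label => -[] ji; have ip : (i < p)%N by have := ltn_ord j; lia.
have := H i ip; rewrite /plabel -ji !inord_val !P; lia.
Qed.

Lemma endpointsE (p : nat) (pi : 'S_p.+1) (a b : nat) :
  endpoints pi a b <-> plabel pi 0 = a /\ plabel pi p = b.
Proof.
split=> [[i [j [[i0] [jp] <- <-]]]|[<- <-]].
  have -> : i = inord 0 by apply: val_inj; rewrite /= inordK.
  by have -> : j = inord p by apply: val_inj; rewrite /= inordK.
by exists (inord 0), (inord p); rewrite /label !inordK.
Qed.

(** Centered values are odd here, hence nonzero: every weak crossing is strict, and end deviations
    adding up to 2 are both 1. *)
Lemma extremal_even (m p : nat) (pi : 'S_p.+1) : p.+1 = (2 * m)%N ->
  extremal pi <->
    oscillates pi (label_range p.+1 1 m) (label_range p.+1 m.+1 p.+1) /\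
    (endpoints pi m m.+1 \/ endpoints pi m.+1 m).
Proof.
move=> pm; rewrite oscillatesE !endpointsE.
have ne : plabel pi 0 <> plabel pi p.
  by move=> /plabel_inj => /(_ isT (leqnn _)); lia.
split=> -[H E]; (split; last by move: E; rewrite /centered; lia) => i ip.
  have /eqP := H i ip; rewrite slack_eq0 /centered; lia.
have := H i ip => O; apply/eqP; rewrite slack_eq0 /centered; lia.
Qed.

(* Signs alternate from 0 on, so u is positive at the odd positions; as p is
   even, its zero at p can be counted as nonpositive. *)
Lemma weak_alternation (u : nat -> int) (p : nat) : ~~ odd p ->
  (forall i, (i < p)%N -> slack (u i) (u i.+1) = 0) ->
  (forall i, (i < p)%N -> u i != 0) -> u 0 < 0 -> u p = 0 ->
  forall i, (i < p)%N -> (u i <= 0) != (u i.+1 <= 0).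
Proof.
move=> op S nz u0 up.
have sgn i : (i < p)%N -> (u i < 0) = ~~ odd i.
  elim: i => [|i IH] ip; first by rewrite u0.
  have := IH (ltnW ip); have /eqP := S i (ltnW ip); rewrite slack_eq0.
  by have := nz _ ip; have := nz _ (ltnW ip) => /=; lia.
have sgnp i : (i <= p)%N -> (u i <= 0) = ~~ odd i.
  rewrite leq_eqVlt => /orP[/eqP->|ip]; first by rewrite up op.
  by rewrite -sgn // le_eqVlt (negPf (nz _ ip)).
by move=> i ip; rewrite !sgnp //= ?(ltnW ip) //; case: odd.
Qed.

(** Since [slack] is symmetric, [weak_alternation] applies to the sequence read backwards. *)
Lemma weak_alternation_rev (u : nat -> int) (p : nat) : ~~ odd p ->
  (forall i, (i < p)%N -> slack (u i) (u i.+1) = 0) ->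
  (forall i, (0 < i <= p)%N -> u i != 0) -> u p < 0 -> u 0 = 0 ->
  forall i, (i < p)%N -> (u i <= 0) != (u i.+1 <= 0).
Proof.
move=> op S nz up u0 i ip.
have := @weak_alternation (fun k => u (p - k)%N) p op.
rewrite subn0 subnn => /(_ _ _ up u0 (p - i.+1)%N).
rewrite subKn // (_ : p - (p - i.+1).+1 = i)%N; last by lia.
rewrite eq_sym; apply; [|by move=> k kp; apply: nz; lia|by lia].
move=> k kp; have := S (p - k.+1)%N.
by rewrite subnSK // /slack => /(_ (leq_subr _ _)); lia.
Qed.

(** Centered values are even here, so one end is the median m + 1 and the other is m or m + 2. An
    even number of alternations puts both ends on the same side, so the median joins the lower block
    if the other end is m and the upper block if it is m + 2. *)
Lemma extremal_odd (m p : nat) (pi : 'S_p.+1) :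
  (0 < m)%N -> p.+1 = (2 * m + 1)%N ->
  extremal pi <->
    (oscillates pi (label_range p.+1 1 m) (label_range p.+1 m.+1 p.+1) /\
     (endpoints pi m.+1 m.+2 \/ endpoints pi m.+2 m.+1)) \/
    (oscillates pi (label_range p.+1 1 m.+1) (label_range p.+1 m.+2 p.+1) /\
     (endpoints pi m m.+1 \/ endpoints pi m.+1 m)).
Proof.
move=> m0 pm; rewrite !oscillatesE !endpointsE.
have inj := @plabel_inj p pi.
have ne : plabel pi 0 <> plabel pi p by move=> /inj => /(_ isT (leqnn _)); lia.
have op : ~~ odd p by lia.
split=> [[H E]|].
  have : plabel pi 0 = m.+1 /\ (plabel pi p = m \/ plabel pi p = m.+2) \/
         plabel pi p = m.+1 /\ (plabel pi 0 = m \/ plabel pi 0 = m.+2).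
    by move: E; rewrite /centered; lia.
  (* Negation swaps the two sides and so reduces an end at m + 2 to the case of a negative end. *)
  have HN i : (i < p)%N -> slack (- centered pi i) (- centered pi i.+1) = 0.
    by move=> /H; rewrite /slack; lia.
  case=> -[c [] e].
  - right; split=> [i ip|]; last by right.
    have nz k : (0 < k <= p)%N -> centered pi k != 0.
      by move=> kp; have := inj k 0%N; rewrite /centered c; lia.
    have uneg : centered pi p < 0 by rewrite /centered e; lia.
    have uzero : centered pi 0 = 0 by rewrite /centered c; lia.
    have := weak_alternation_rev op H nz uneg uzero ip.
    by rewrite /centered; lia.
  - left; split=> [i ip|]; last by left.
    have nz k : (0 < k <= p)%N -> - centered pi k != 0.
      by move=> kp; have := inj k 0%N; rewrite /centered c; lia.
    have uneg : - centered pi p < 0 by rewrite /centered e; lia.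
    have uzero : - centered pi 0 = 0 by rewrite /centered c; lia.
    have := weak_alternation_rev op HN nz uneg uzero ip.
    by rewrite /centered; lia.
  - right; split=> [i ip|]; last by left.
    have nz k : (k < p)%N -> centered pi k != 0.
      by move=> kp; have := inj k p; rewrite /centered c; lia.
    have uneg : centered pi 0 < 0 by rewrite /centered e; lia.
    have uzero : centered pi p = 0 by rewrite /centered c; lia.
    have := weak_alternation op H nz uneg uzero ip.
    by rewrite /centered; lia.
  - left; split=> [i ip|]; last by right.
    have nz k : (k < p)%N -> - centered pi k != 0.
      by move=> kp; have := inj k p; rewrite /centered c; lia.
    have uneg : - centered pi 0 < 0 by rewrite /centered e; lia.
    have uzero : - centered pi p = 0 by rewrite /centered c; lia.
    have := weak_alternation op HN nz uneg uzero ip.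
    by rewrite /centered; lia.
case=> -[H E]; (split; last by move: E; rewrite /centered; lia) => i ip;
  apply/eqP; rewrite slack_eq0 /centered; have := H i ip; lia.
Qed.

(** * A zigzag permutation attaining the bound *)

(* In labels: the median (rounded down), n, 1, n - 1, 2, n - 2, ... *)
Definition witness (p k : nat) : nat :=
  if k == 0%N then p./2 else if odd k then (p - k./2)%N else (k./2).-1.

Lemma extremal_exists (p : nat) : (0 < p)%N -> exists pi : 'S_p.+1, extremal pi.
Proof.
move=> p0.
have wlt k : (k <= p)%N -> (witness p k <= p)%N.
  by rewrite /witness; do ?[case: ifP => ?]; lia.
have winj : injective (fun k : 'I_p.+1 => inord (witness p k) : 'I_p.+1).
  (* Odd positions fill the labels above the start from the top down, positive even ones those below
     it from the bottom up. *)
  move=> j k /(congr1 val) /=; have := ltn_ord j; have := ltn_ord k.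
  rewrite !ltnS => kp jp; rewrite !inordK ?ltnS ?wlt // /witness => E.
  by apply: val_inj => /=; move: E; do ?[case: ifP => ?]; lia.
exists (perm winj).
have L k : (k <= p)%N -> plabel (perm winj) k = (witness p k).+1.
  move=> kp; rewrite /plabel permE /label (inordK (_ : (k < p.+1)%N)) //.
  by rewrite inordK ?ltnS ?wlt.
(* The zigzag ends at label m + 1 if n = 2m and at m if n = 2m + 1, so the end deviations are 1 + 1
   or 0 + 2. *)
split; last by rewrite /centered !L // /witness eqxx; do ?[case: ifP => ?]; lia.
move=> i ip; apply/eqP; rewrite slack_eq0 /centered !L ?(ltnW ip) //.
by rewrite /witness; do ?[case: ifP => ?]; lia.
Qed.

(** * The maximum and its maximizers *)

Lemma max_stretch (p : nat) : (0 < p)%N ->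
  max_stretch_is p.+1 ((total_deviation p.+1 - 1)%:~R / p%:R) /\
  (forall pi : 'S_p.+1, attains_max pi <-> extremal pi).
Proof.
move=> p0; have pR : (0 : rat) < p%:R^-1 by rewrite invr_gt0 ltr0n.
have le (pi : 'S_p.+1) :
    additive_stretch pi <= (total_deviation p.+1 - 1)%:~R / p%:R.
  by rewrite additive_stretchE ler_pM2r // ler_int stretch_sum_le.
have [rho rhoE] := extremal_exists p0.
have eqE (pi : 'S_p.+1) : extremal pi <->
    additive_stretch pi = (total_deviation p.+1 - 1)%:~R / p%:R.
  rewrite -stretch_sum_eq // additive_stretchE; split=> [->//|].
  by move/(mulIf (lt0r_neq0 pR))/intr_inj.
split; first by split; [exists rho; apply/eqE|].
move=> pi; split=> [M|/eqE E sigma]; last by rewrite E.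
(* A maximizer does at least as well as [rho], which already reaches the bound. *)
apply/eqE/le_anti; rewrite le /=; move/eqE: rhoE => <-; exact: M.
Qed.

Theorem theorem3p1 (n : nat) (hn : (2 <= n)%N) :
  (forall m : nat, n = (2 * m)%N ->
     max_stretch_is n ((2 * m%:R ^+ 2 - 1) / (2 * m%:R - 1)) /\
     (forall pi : 'S_n, attains_max pi <->
        oscillates pi (label_range n 1 m) (label_range n m.+1 n) /\
        (endpoints pi m m.+1 \/ endpoints pi m.+1 m))) /\
  (forall m : nat, n = (2 * m + 1)%N ->
     max_stretch_is n ((2 * m%:R ^+ 2 + 2 * m%:R - 1) / (2 * m%:R)) /\
     (forall pi : 'S_n, attains_max pi <->
        (oscillates pi (label_range n 1 m) (label_range n m.+1 n) /\
         (endpoints pi m.+1 m.+2 \/ endpoints pi m.+2 m.+1)) \/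
        (oscillates pi (label_range n 1 m.+1) (label_range n m.+2 n) /\
         (endpoints pi m m.+1 \/ endpoints pi m.+1 m)))).
Proof.
case: n hn => [//|p] p0; have [M A] := max_stretch p0.
have pE : p%:R = p.+1%:R - 1 :> rat by rewrite -natr1 addrK.
split=> m pm.
  split; last by move=> pi; rewrite A; exact: extremal_even.
  (* The first [p.+1] is the size argument of [max_stretch_is], which the goal keeps; only the value
     is rewritten. *)
  move: M; rewrite pE {2 3}pm total_deviation_even natrM.
  by rewrite rmorphB rmorphM rmorphXn /= !natz.
have m0 : (0 < m)%N by lia.
split; last by move=> pi; rewrite A; exact: extremal_odd.
move: M; rewrite pE {2 3}pm total_deviation_odd natrD natrM addrK.
by rewrite rmorphB rmorphD rmorphM rmorphXn rmorphM /= !natz.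
Qed.
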